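(* Assume the Dickson–Hardy–Littlewood conjecture: for every finite admissible set $H\subset\mathbb{N}$ there exist infinitely many $n\in\mathbb{N}$ with $n+H\subset\mathbb{P}$. Then for every $k\in\mathbb{N}$ there exists an infinite set $B\subset\mathbb{N}$ such that $\mathbb{P}-1\supset\{\sum_{n\in F}n: F\subset B,\ 0<|F|\leq k\}$; and likewise for every $k\in\mathbb{N}$ there exists an infinite set $B\subset\mathbb{N}$ such that $\mathbb{P}+1\supset\{\sum_{n\in F}n: F\subset B,\ 0<|F|\leq k\}$.
   Context: $\mathbb{P}$ denotes the set of primes, $\mathbb{P}\pm1=\{p\pm1:p\in\mathbb{P}\}$ and $n+H=\{n+h:h\in H\}$. A set $H\subset\mathbb{N}$ is admissible if for every prime $p$ there exists $i\in\mathbb{N}$ such that no element of $H$ is congruent to $i$ modulo $p$. *)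

(* Defs.v *)
From mathcomp Require Import all_boot finmap.
From mathcomp Require Import all_classical.
Set Implicit Arguments.
Unset Strict Implicit.
Unset Printing Implicit Defensive.

Local Open Scope classical_set_scope.
Local Open Scope nat_scope.

(* The natural numbers are 1, 2, 3, ..., realized inside nat. *)
Definition positives : set nat := [set n | 0 < n].

Definition primes_set : set nat := [set p | prime p].

(* Every prime is positive, so the truncated predecessor is p - 1. *)
Definition primes_minus1 : set nat := [set p.-1 | p in primes_set].

Definition primes_plus1 : set nat := [set p.+1 | p in primes_set].

Definition translate (n : nat) (H : set nat) : set nat := [set n + h | h in H].

Definition admissible (H : set nat) : Prop :=
  forall p, prime p ->
    exists2 i, positives i & forall h, H h -> h <> i %[mod p].

Definition dickson_hardy_littlewood : Prop :=
  forall H : set nat, H `<=` positives -> finite_set H -> admissible H ->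
    infinite_set [set n | positives n /\ translate n H `<=` primes_set].

Definition bounded_sums (k : nat) (B : set nat) : set nat :=
  [set \sum_(n <- F) n | F in
    [set F : {fset nat} | [set` F] `<=` B /\ 0 < #|` F|%fset <= k]].

(* Main.v *)
Require Import Defs.
From mathcomp Require Import all_boot finmap.
From mathcomp Require Import all_classical.
From mathcomp Require Import zify.
Local Open Scope classical_set_scope.
Local Open Scope nat_scope.

(** The set [B] is built one element at a time.  Given a finite [A] whose sums
    are good, a new element [b] must make all translates [b + s] prime up to the
    shift, for [s] a sum of fewer than [k] elements of [A].  Admissibility of
    these translates is kept alive by strengthening it to a condition on [k]-fold
    sums with repetitions of a class [c] modulo [p] ([extendable]): if [b = c]
    modulo every [p <= N], the condition is inherited at those [p], while for
    [p > N] it holds for any [b] because there are fewer forbidden classes than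
    [p].  The shifts [P - 1] and [P + 1] are the cases [d = 0] and [d = 2] of
    sums of the form [q + d - 1] with [q] prime. *)

(** Pigeonhole: each [t] excludes at most one class below [m], namely [bad t]. *)
Lemma exists_avoiding (T : eqType) (P : T -> pred nat) (s : seq T) (m : nat) :
  size s < m ->
  (forall t c c', t \in s -> c < m -> c' < m -> P t c -> P t c' -> c = c') ->
  exists2 c, c < m & forall t, t \in s -> ~~ P t c.
Proof.
move=> ltsm Puniq; pose bad t := find (P t) (iota 0 m).
have [c] : exists2 c, c \in iota 0 m & c \notin map bad s.
  apply/hasP; apply: contraLR ltsm => /hasPn sub.
  rewrite -leqNgt -(size_map bad s) -[m in m <= _](size_iota 0).
  by apply: uniq_leq_size (iota_uniq _ _) _ => c /sub /negPn.
rewrite mem_iota => /andP[_ ltcm] cNbad; exists c => // t ts; apply/negP => Ptc.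
have hasP : has (P t) (iota 0 m) by apply/hasP; exists c; rewrite ?mem_iota.
have ltbad : bad t < m by rewrite -[m in _ < m](size_iota 0) -has_find.
have := nth_find 0 hasP; rewrite nth_iota // add0n => Pbad.
by move/negP: cNbad; apply; rewrite (Puniq t c (bad t)) ?map_f.
Qed.

Lemma chinese_primes (N : nat) (f : nat -> nat) :
  exists2 x, 0 < x & forall p, prime p -> p <= N -> x = f p %[mod p].
Proof.
suff [x xf] : exists x, forall p, prime p -> p <= N -> x = f p %[mod p].
  exists (N`! + x) => [|p pp leN]; first by rewrite ltn_addr ?fact_gt0.
  have /eqP dvd : p %| N`! by rewrite dvdn_fact ?prime_gt0.
  by rewrite -modnDml dvd add0n xf.
elim: N => [|N [x xf]]; first by exists 0 => p /prime_gt0; lia.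
have [pN|NpN] := boolP (prime N.+1); last first.
  exists x => p pp; rewrite leq_eqVlt => /orP[/eqP ep|]; last exact: xf.
  by rewrite -ep pp in NpN.
have cop : coprime N`! N.+1.
  rewrite coprime_sym prime_coprime // fact_prod Euclid_dvd_prod //.
  apply/negP; rewrite big_has => /hasP[i]; rewrite mem_index_iota => Hi /dvdn_leq.
  by lia.
exists (chinese N`! N.+1 x (f N.+1)) => p pp.
rewrite leq_eqVlt => /orP[/eqP ->|lepN]; first exact: chinese_modr.
have dvd : p %| N`! by rewrite dvdn_fact ?prime_gt0.
by rewrite -(xf p) // -(modn_dvdm _ dvd) chinese_modl // modn_dvdm.
Qed.

Lemma infinite_set_gt (A : set nat) (M : nat) :
  infinite_set A -> exists2 n, A n & M < n.
Proof.
move=> Ainf; apply: contrapT => H; apply: Ainf.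
apply: (@sub_finite_set _ _ `I_M.+1); last exact: finite_II.
by move=> n An /=; rewrite ltnS leqNgt; apply/negP => ltMn; apply: H; exists n.
Qed.

(* The conjecture only speaks about translates [n + H], but a congruence
   [n = c] mod [p] can be forced by adding to [H] an element in every class
   other than [- c] mod [p]. *)
Lemma dhl_congruences (H : seq nat) (c : nat -> nat) (N M : nat) :
  dickson_hardy_littlewood ->
  (forall h, h \in H -> 0 < h) ->
  (forall p h, prime p -> h \in H -> ~~ (p %| c p + h)) ->
  exists n, [/\ M < n, forall h, h \in H -> prime (n + h) &
    forall p, prime p -> p <= N -> n = c p %[mod p]].
Proof.
(* [N'] will be the size of the enlarged set [H'], so primes above it have a free class by
   counting. *)
move=> DHL Hpos Hc; pose N' := size H + N.
(* The class [j] itself, moved to the next one only when [j] is [- c p]. *)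
pose r j p := if p %| c p + j then j.+1 else j.
have rP j p : prime p -> ~~ (p %| c p + r j p).
  rewrite /r => pp; case: ifPn => // dvd; rewrite addnS -addn1 dvdn_addr //.
  by rewrite dvdn1 neq_ltn prime_gt1 // orbT.
have /choice[x xP] j : exists x, 0 < x /\
    forall p, prime p -> p <= N' -> x = r j p %[mod p].
  by have [x] := chinese_primes N' (r j); exists x.
pose H' := H ++ [seq x j | j <- iota 0 N].
have sH' : size H' = N' by rewrite size_cat size_map size_iota.
have H'c p h : prime p -> p <= N' -> h \in H' -> ~~ (p %| c p + h).
  move=> pp leN; rewrite mem_cat => /orP[|/mapP[j _ ->]]; first exact: Hc.
  by rewrite /dvdn -modnDmr (xP j).2 // modnDmr -/(dvdn _ _) rP.
have adm : admissible [set` H'].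
  move=> p pp; have p0 := prime_gt0 pp; have [leN|ltN] := leqP p N'.
    have lec : c p < (c p).+1 * p by rewrite leq_pmulr.
    (* A positive representative of [- c p]. *)
    exists ((c p).+1 * p - c p); first by rewrite /positives /= subn_gt0.
    move=> h /= hH' eqh; have /negP[] := H'c p h pp leN hH'.
    by rewrite /dvdn -modnDmr eqh modnDmr subnKC ?modnMl // ltnW.
  have [||i _ iP] := @exists_avoiding _ (fun h i => h == i %[mod p]) H' p.
  - by rewrite sH'.
  - move=> h i i' _ ip i'p /eqP -> /eqP; rewrite !modn_small // => ->.
  exists (i + p); first by rewrite /positives /= ltn_addl.
  by move=> h /= /iP /eqP ne; rewrite modnDr.
have pos : [set` H'] `<=` positives.
  move=> h /=; rewrite mem_cat => /orP[/Hpos //|/mapP[j _ ->]].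
  exact: (xP j).1.
have [n [_ nH'] ltn] := @infinite_set_gt _ (M + N) (DHL _ pos (finite_seq H') adm).
have prH' h : h \in H' -> prime (n + h) by move=> hH'; apply: nH'; exists h.
exists n; split=> [|h hH|p pp leN]; first by lia.
  by apply: prH'; rewrite mem_cat hH.
have p0 := prime_gt0 pp.
(* [j] is the class of [- n]. Were it not that of [- c p], then [x j = j] modulo [p], so [p] would
   divide the prime [n + x j], which exceeds [N >= p]. *)
have [j jp nj] : exists2 j, j < p & n + j = 0 %[mod p].
  exists ((n * p - n) %% p); first by rewrite ltn_mod.
  by rewrite modnDmr subnKC ?modnMl ?mod0n // leq_pmulr.
have xjH' : x j \in H' by rewrite mem_cat map_f ?orbT // mem_iota /=; lia.
have rj : r j p != j.
  apply/eqP => erj; have := prH' _ xjH'.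
  have dvd : p %| n + x j.
    by rewrite /dvdn -modnDmr (xP j).2 ?erj ?modnDmr ?nj ?mod0n // (leq_trans leN) ?leq_addl.
  by move=> prx; move: dvd; rewrite dvdn_prime2 // => /eqP; lia.
have /eqP cj : p %| c p + j by move: rj; rewrite /r; case: ifP => //; rewrite eqxx.
by apply/eqP; rewrite -(eqn_modDr j) nj cj mod0n.
Qed.

Local Notation fsum F := (\sum_(n <- F) n).

(* Every prime [p] has a class [c] such that, modulo [p], [A] may be enlarged by
   any number of elements of class [c] without a new sum [s] of at most [k]
   elements making [s + 1 - d], which has to be prime, divisible by [p].  For [j = 1] this is admissibility of the translates that
   have to be prime when [A] is enlarged by one element. *)
Definition extendable (k d : nat) (A : {fset nat}) : Prop :=
  forall p, prime p -> exists c, forall j (F : {fset nat}),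
    0 < j -> (F `<=` A)%fset -> j + #|` F| <= k ->
    j * c + (fsum F).+1 <> d %[mod p].

(** The hypothesis says that [p] does not divide [d - 1]; it rules out [d = 1], the unshifted
    primes. *)
Lemma extendable0 k d : (forall p, prime p -> 1 <> d %[mod p]) ->
  extendable k d fset0.
Proof.
move=> Hd p pp; exists 0 => j F _; rewrite fsubset0 => /eqP -> _.
by rewrite muln0 add0n big_seq_fset0; exact: Hd.
Qed.

(* For [p] large compared with [k] and [A], counting suffices: each pair
   [(j, F)] excludes at most one class. *)
Lemma extendable_large (k d : nat) (A : {fset nat}) (p : nat) : prime p ->
  k * 2 ^ #|` A| < p -> exists c, forall j (F : {fset nat}),
    0 < j -> (F `<=` A)%fset -> j + #|` F| <= k ->
    j * c + (fsum F).+1 <> d %[mod p].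
Proof.
move=> pp ltp.
pose P (t : nat * {fset nat}) c := t.1 * c + (fsum t.2).+1 == d %[mod p].
pose s := [seq (j, F) | j <- iota 1 k, F <- enum_fset (fpowerset A)].
have ss : size s < p by rewrite size_allpairs size_iota -card_fpowerset in ltp *.
(* Every [j] from 1 to [k] is thus invertible modulo [p], so a pair [(j, F)] determines the class it
   excludes. *)
have ltkp : k < p by apply: leq_ltn_trans ltp; rewrite leq_pmulr // expn_gt0.
have [|c _ cP] := @exists_avoiding _ P s p ss.
  move=> t c c' /allpairsP[[j F] /= [+ _ ->]] cp c'p.
  rewrite mem_iota /P /= => jk /eqP <-; rewrite eqn_modDr.
  have cop : coprime p j.
    by rewrite prime_coprime //; apply/negP => /dvdn_leq; lia.
  wlog lec : c c' cp c'p / c <= c' => [wl|].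
    case: (leqP c c') => [|/ltnW] le e; first by apply: wl.
    by apply/esym/wl => //; rewrite eq_sym.
  rewrite eqn_mod_dvd ?leq_mul2l ?lec ?orbT // -mulnBr Gauss_dvdr //.
  by rewrite -eqn_mod_dvd // !modn_small // => /eqP ->.
exists c => j F j0 FA jF; apply/eqP; apply: (cP (j, F)).
by apply/allpairsP; exists (j, F); rewrite mem_iota fpowersetE /=; split => //; lia.
Qed.

Lemma fset1U_sub (b : nat) (A F : {fset nat}) : (F `<=` b |` A)%fset ->
  (F `<=` A)%fset \/ exists F' : {fset nat},
    [/\ (F' `<=` A)%fset, #|` F| = #|` F'|.+1 & fsum F = b + fsum F'].
Proof.
move=> FbA; have [bF|bNF] := boolP (b \in F); [right|left].
  exists (F `\ b)%fset; split; first by rewrite fsubDset.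
    by rewrite (cardfsD1 b) bF.
  by rewrite (big_fsetD1 b bF).
apply/fsubsetP => x xF; move/fsubsetP/(_ _ xF): FbA.
by rewrite !inE => /orP[/eqP xb|//]; rewrite -xb xF in bNF.
Qed.

Lemma extend (k d : nat) (A : {fset nat}) :
  dickson_hardy_littlewood -> extendable k d A ->
  exists b, [/\ 0 < b, b \notin A, extendable k d (b |` A)%fset &
    forall F : {fset nat}, (F `<=` A)%fset -> #|` F| < k ->
      exists2 q, prime q & q + d = (b + fsum F).+1].
Proof.
move=> DHL Aext.
have /choice[c cP] p : exists c, prime p -> forall j (F : {fset nat}),
    0 < j -> (F `<=` A)%fset -> j + #|` F| <= k ->
    j * c + (fsum F).+1 <> d %[mod p].
  have [/Aext[c cP]|Np] := boolP (prime p); first by exists c.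
  by exists 0.
pose H := [seq (fsum F).+1 | F : {fset nat} <- fpowerset A & #|` F| < k].
(* The bound of [extendable_large] for the enlarged set. *)
pose N := k * 2 ^ #|` A|.+1.
have HP h : h \in H -> exists F : {fset nat},
    [/\ (F `<=` A)%fset, #|` F| < k & h = (fsum F).+1].
  move=> /mapP[F]; rewrite mem_filter => /andP[Fk FA] ->; exists F.
  by move: FA; rewrite fpowersetE.
(* The new element is [b = n + d], so [n] must be [c p - d] modulo [p], written with [p.-1 * d] for
   [- d]. Asking for [n > fsum A] makes [b] new. *)
have [||n [ltn prH nc]] := @dhl_congruences H (fun p => c p + p.-1 * d) N
    (fsum A) DHL.
- by move=> h /HP[F [_ _ ->]].
- move=> p h pp /HP[F [FA Fk ->]]; apply/negP => /eqP e.
  apply: (cP p pp 1 F) => //; rewrite mul1n.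
  apply/eqP; rewrite -(eqn_modDr (p.-1 * d)).
  rewrite addnAC e -mulSn prednK ?prime_gt0 //.
  by rewrite modnMr.
have bc p : prime p -> p <= N -> n + d = c p %[mod p].
  move=> pp leN; rewrite -modnDml nc // modnDml -addnA -mulSnr.
  by rewrite prednK ?prime_gt0 // -modnDmr modnMr addn0.
exists (n + d); split; first by lia.
- apply/negP => bA; move: ltn; rewrite (big_fsetD1 _ bA) /=; lia.
- move=> p pp; have [leN|ltN] := leqP p N; last first.
    apply: extendable_large => //; apply: leq_ltn_trans ltN.
    rewrite leq_mul2l leq_exp2l // cardfsU1; lia.
  exists (c p) => j F j0 /fset1U_sub[FA|[F' [F'A cF eF]]] jF.
    exact: cP.
  (* Modulo [p], [b] is one more copy of [c p]: [j] grows by one while [F] loses an element. *)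
  rewrite eF -addnS addnCA -modnDml bc // modnDml addnA -mulSn.
  by apply: cP => //; lia.
- move=> F FA Fk; exists (n + (fsum F).+1); last by lia.
  by apply/prH/mapP; exists F; rewrite // mem_filter Fk fpowersetE.
Qed.

Lemma infinite_bounded_sums (k d : nat) : dickson_hardy_littlewood ->
  (forall p, prime p -> 1 <> d %[mod p]) ->
  exists B : set nat, [/\ B `<=` positives, infinite_set B &
    forall s, bounded_sums k B s -> exists2 q, prime q & q + d = s.+1].
Proof.
move=> DHL Hd.
pose good (A : {fset nat}) := [/\ extendable k d A, [set` A] `<=` positives &
  forall F : {fset nat}, (F `<=` A)%fset -> 0 < #|` F| <= k ->
    exists2 q, prime q & q + d = (fsum F).+1].
(* Stated as an implication so that [R] is total, as dependent choice requires. *)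
pose R (A A' : {fset nat}) := good A ->
  [/\ good A', (A `<=` A')%fset & #|` A'| = #|` A|.+1].
have Rtot A : {A' | R A A'}.
  apply: cid; have [[Aext Apos AP]|] := EM (good A); last by exists A.
  have [b [b0 bA bext bP]] := extend k d A DHL Aext.
  exists (b |` A)%fset => _; split; [split => //| exact: fsubsetU1|].
  - by move=> x /=; rewrite !inE => /orP[/eqP ->|/Apos].
  - move=> F /fset1U_sub[FA|[F' [F'A -> ->]]]; first exact: AP.
    by move=> /andP[_ F'k]; apply: bP.
  - by rewrite cardfsU1 bA.
have [A [A0 AR]] := dependent_choice Rtot fset0.
have Agood m : good (A m).
  elim: m => [|m /(AR m)[]//]; rewrite A0; split=> //.
    exact: extendable0.
  by move=> F; rewrite fsubset0 => /eqP ->; rewrite cardfs0.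
have Amono m m' : m <= m' -> (A m `<=` A m')%fset.
  elim: m' => [|m' IH]; first by rewrite leqn0 => /eqP ->.
  rewrite leq_eqVlt => /orP[/eqP -> //|/IH /fsubset_trans]; apply.
  by have [] := AR m' (Agood m').
have Acard m : #|` A m| = m.
  by elim: m => [|m IH]; [rewrite A0 cardfs0|have [_ _ ->] := AR m (Agood m); rewrite IH].
exists [set x | exists m, x \in A m]; split.
- by move=> x [m]; have [_ + _] := Agood m; apply.
- apply/infinite_set_fsetP => m; exists (A m); last by rewrite Acard.
  by move=> x /= xA; exists m.
- move=> _ [F [FB Fk] <-].
  suff [m FA] : exists m, (F `<=` A m)%fset.
    by have [_ _] := Agood m; apply.
  have /choice[g gP] x : exists m, x \in F -> x \in A m.
    have [/FB[m xA]|_] := boolP (x \in F); first by exists m.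
    by exists 0.
  (* A finite subset of the increasing union lies in one stage. *)
  exists (\max_(x <- F) g x); apply/fsubsetP => x xF.
  by apply: (fsubsetP (Amono _ _ (leq_bigmax_seq _ xF _))) => //; exact: gP.
Qed.

Theorem theoremB3 (DHL : dickson_hardy_littlewood) :
  (forall k : nat, exists B : set nat,
     [/\ B `<=` positives, infinite_set B &
         bounded_sums k B `<=` primes_minus1]) /\
  (forall k : nat, exists B : set nat,
     [/\ B `<=` positives, infinite_set B &
         bounded_sums k B `<=` primes_plus1]).
Proof.
split=> k.
  have [p /prime_gt1 p1|B [Bpos Binf BP]] := infinite_bounded_sums k 0 DHL.
    by rewrite mod0n modn_small.
  exists B; split=> // s /BP[q pq eq]; exists q => //; lia.
have [p /prime_gt1 p1 /eqP|B [Bpos Binf BP]] := infinite_bounded_sums k 2 DHL.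
  by rewrite eq_sym eqn_mod_dvd // dvdn1 => /eqP ep; rewrite ep in p1.
exists B; split=> // s /BP[q pq eq]; exists q => //; lia.
Qed.
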